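(* Let $\Delta_2=\{(p_1,p_2,p_3)\in(0,1)^3 : p_1+p_2+p_3=1\}$. There exists a rational function $g:\Delta_2\to(0,1)$ such that: (i) $g$ is polynomially bounded away from $0$ and $1$, i.e. there exist constants $c>0$ and $k\ge 1$ such that $$\min\bigl(g(\mathbf p),\,1-g(\mathbf p)\bigr)\ \ge\ c\,\prod_{i=1}^{3}p_i^{k}\qquad\text{for all }\mathbf p=(p_1,p_2,p_3)\in\Delta_2,$$ and hence $g$ admits a Bernoulli factory; but (ii) $g$ cannot be implemented by a finite-automata Bernoulli factory, i.e. there do not exist Bernstein polynomials $A,B\in\mathbb R[p_1,p_2,p_3]$, with $B$ not the zero polynomial, such that $g(\mathbf p)=A(\mathbf p)/B(\mathbf p)$ for all $\mathbf p\in\Delta_2$.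
   Context: For $s\ge 1$, $\Delta_s=\{\mathbf p=(p_1,\dots,p_{s+1})\in(0,1)^{s+1}:\sum_{i=1}^{s+1}p_i=1\}$ is the open $s$-dimensional simplex. Rational function: $f:\Delta_s\to(0,1)$ is rational if $f(\mathbf p)=P(\mathbf p)/Q(\mathbf p)$ for all $\mathbf p\in\Delta_s$, where $P,Q\in\mathbb R[p_1,\dots,p_{s+1}]$ and $Q$ does not vanish on $\Delta_s$. Bernoulli factory: $f:\Delta_s\to(0,1)$ admits a Bernoulli factory if there is a procedure, not depending on $\mathbf p$, which reads i.i.d. samples $X_1,X_2,\dots$ in $\{1,\dots,s+1\}$ with $\Pr(X_j=i)=p_i$ (for an unknown $\mathbf p\in\Delta_s$), possibly also using auxiliary randomness $U$ uniform on $[0,1]$ and independent of the samples, and which for every $\mathbf p\in\Delta_s$ almost surely stops after finitely many samples and outputs a bit equal to $1$ with probability exactly $f(\mathbf p)$. Formally: there are a stopping time $T$ for the filtration $\sigma(U,X_1,\dots,X_n)$, $n\ge 0$, and a $\{0,1\}$-valued output that is a measurable function of $(U,X_1,\dots,X_T)$, both defined by rules independent of $\mathbf p$, such that for every $\mathbf p\in\Delta_s$ one has $T<\infty$ almost surely and $\Pr(\text{output}=1)=f(\mathbf p)$. Bernstein polynomial: a polynomial in $\mathbb R[p_1,\dots,p_{s+1}]$ is called a Bernstein polynomial if it is homogeneous (of some degree $d$) and all its coefficients are non-negative, i.e. it has the form $\sum_\alpha c_\alpha p_1^{\alpha_1}\cdots p_{s+1}^{\alpha_{s+1}}$ with all $c_\alpha\ge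 0$ and $\sum_i\alpha_i=d$ for each $\alpha$ occurring. Finite-automata Bernoulli factory: a rational function $f:\Delta_s\to(0,1)$ is said to be implementable by a finite-automata Bernoulli factory (also called simulation via blocks) if and only if there exist Bernstein polynomials $A,B$, with $B$ not the zero polynomial, such that $f(\mathbf p)=A(\mathbf p)/B(\mathbf p)$ for all $\mathbf p\in\Delta_s$. This criterion is taken as the meaning of the term here. *)

(* Defs.v *)
From HB Require Import structures.
From mathcomp Require Import all_boot all_order all_algebra.
From mathcomp Require mpoly.

Set Implicit Arguments.
Unset Strict Implicit.
Unset Printing Implicit Defensive.

Import Order.TTheory GRing.Theory Num.Theory.

Local Open Scope ring_scope.

(* Functions on the simplex are represented by total functions on
   'I_s.+1 -> R; no definition below looks at their values off the simplex. *)

Definition open_simplex (R : realFieldType) (s : nat) (p : 'I_s.+1 -> R) : Prop :=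
  (forall i, 0 < p i < 1) /\ \sum_i p i = 1.

Definition maps_into_unit (R : realFieldType) (s : nat)
    (f : ('I_s.+1 -> R) -> R) : Prop :=
  forall p, open_simplex p -> 0 < f p < 1.

Definition polynomially_bounded (R : realFieldType) (s : nat)
    (f : ('I_s.+1 -> R) -> R) : Prop :=
  exists c : R, exists k : nat, [/\ 0 < c, (1 <= k)%N &
    forall p, open_simplex p ->
      c * \prod_i p i ^+ k <= Num.min (f p) (1 - f p)].

(* mpoly is imported in a module, and mathcomp-analysis loaded only after it,
   because their notations clash. *)
Module MultivariatePolynomials.
Import mpoly.

Definition rational_on_simplex (R : realFieldType) (s : nat)
    (f : ('I_s.+1 -> R) -> R) : Prop :=
  exists P Q : {mpoly R[s.+1]}, forall p, open_simplex p ->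
    Q.@[p] != 0 /\ f p = P.@[p] / Q.@[p].

Definition bernstein (R : realFieldType) (n : nat) (A : {mpoly R[n]}) : Prop :=
  (exists d : nat, A \is d.-homog) /\ (forall m : 'X_{1..n}, 0 <= A@_m).

(* A and B may have different degrees. *)
Definition finite_automata_factory (R : realFieldType) (s : nat)
    (f : ('I_s.+1 -> R) -> R) : Prop :=
  exists A B : {mpoly R[s.+1]}, [/\ bernstein A, bernstein B, B != 0 &
    forall p, open_simplex p -> f p = A.@[p] / B.@[p]].

End MultivariatePolynomials.
Export MultivariatePolynomials.

From mathcomp Require Import all_classical all_reals all_analysis.
Import numFieldNormedType.Exports.

Local Open Scope classical_set_scope.

(* The samples X_1, X_2, ... are numbered from 0: X n is the (n+1)-st one.
   Independence is the product rule for events of (U, X 0, ..., X n.-1), for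
   every n; taking some of the events to be full gives every finite
   subfamily. *)
Record iid_input (R : realType) (s : nat) (p : 'I_s.+1 -> R)
    (d : measure_display) (Omega : measurableType d) (P : probability Omega R)
    (U : {RV P >-> R}) (X : nat -> Omega -> 'I_s.+1) : Prop := IidInput {
  input_measurable : forall n i, measurable (X n @^-1` [set i]) ;
  input_uniform : forall A : set R, measurable A ->
    distribution P U A = uniform_prob (@ltr01 R) A ;
  input_law : forall n i, P (X n @^-1` [set i]) = (p i)%:E ;
  input_independent :
    forall (n : nat) (A : set R) (E : nat -> set 'I_s.+1), measurable A ->
    P (U @^-1` A `&` \bigcap_(j in [set j | (j < n)%N]) X j @^-1` E j) =
    (P (U @^-1` A) * \prod_(j < n) P (X j @^-1` E j))%E }.

(* A procedure is a map on the space of all inputs (u, (x_1, x_2, ...)).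
   @input_filtration R s n is the sigma-algebra sigma(U, X_1, ..., X_n) on that
   space. *)
Definition input_space (R : realType) (s : nat) : Type :=
  (R * (nat -> 'I_s.+1))%type.

Definition input_filtration (R : realType) (s n : nat) :
    set (set (input_space R s)) :=
  <<s [set E | (exists2 A : set R, measurable A & E = [set w | A w.1]) \/
               (exists j i, (j < n)%N /\ E = [set w | w.2 j = i])] >>.

(* T w = None stands for T = infinity. *)
Definition stopping_time (R : realType) (s : nat)
    (T : input_space R s -> option nat) : Prop :=
  forall n, @input_filtration R s n [set w | T w = Some n].

(* Measurability of the output with respect to the stopped sigma-algebra
   sigma(U, X_1, ..., X_T). *)
Definition stopped_measurable (R : realType) (s : nat)
    (T : input_space R s -> option nat) (out : input_space R s -> bool) : Prop :=
  forall n, @input_filtration R s n [set w | T w = Some n /\ out w].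

Definition admits_bernoulli_factory (R : realType) (s : nat)
    (f : ('I_s.+1 -> R) -> R) : Prop :=
  exists (T : input_space R s -> option nat) (out : input_space R s -> bool),
  [/\ stopping_time T, stopped_measurable T out &
    forall p, open_simplex p ->
    forall (d : measure_display) (Omega : measurableType d)
      (P : probability Omega R) (U : {RV P >-> R})
      (X : nat -> Omega -> 'I_s.+1), iid_input p U X ->
    {ae P, forall o, T (U o, X ^~ o) <> None} /\
    P [set o | T (U o, X ^~ o) <> None /\ out (U o, X ^~ o)] = (f p)%:E].

(* Main.v *)
(* The witness is g(p) = (p_0 - p_1)^2 + p_2 (p_0 + p_1) / 2.

   Bernoulli factory: read samples until the symbol 2 has occurred three times;
   if the other symbols occurred k and l times, with n = k + l, output 1 with
   probability (k - l)^2 / ((n + 1)(n + 2)).  A word with n other symbols has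
   (n + 1)(n + 2) / 2 places for the first two occurrences of 2, which cancels
   the denominator, so that only a series in n^2 x^n remains, x = p_0 + p_1.

   No quotient of Bernstein polynomials: a homogeneous polynomial A with
   non-negative coefficients satisfies a Harnack inequality, A(v) <= M^d A(w)
   whenever v <= M w coordinatewise.  Hence A / B takes comparable values at
   ((1-t)/2, (1-t)/2, t) and ((1-t)/3, 2(1-t)/3, t) uniformly in t, while g
   tends to 0 along the first family and to 1/9 along the second one as t
   tends to 0. *)
Require Import Defs.
From HB Require Import structures.
From mathcomp Require Import all_boot all_order all_algebra.
From mathcomp Require mpoly.
From mathcomp Require Import ring lra.

Set Implicit Arguments.
Unset Strict Implicit.
Unset Printing Implicit Defensive.

Import Order.TTheory GRing.Theory Num.Theory.

Local Open Scope ring_scope.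

(** * Coordinates on the two-dimensional simplex *)

Lemma ord3_ind (Q : 'I_3 -> Prop) : Q 0 -> Q 1 -> Q 2 -> forall i, Q i.
Proof.
move=> Q0 Q1 Q2 [[|[|[|//]]] lti].
- by have -> : Ordinal lti = 0 by exact/val_inj.
- by have -> : Ordinal lti = 1 by exact/val_inj.
- by have -> : Ordinal lti = 2 by exact/val_inj.
Qed.

Lemma big_ord3 (T : Type) (idx : T) (op : Monoid.law idx) (F : 'I_3 -> T) :
  \big[op/idx]_i F i = op (op (F 0) (F 1)) (F 2).
Proof.
rewrite !big_ord_recr big_ord0 /= Monoid.mul1m.
by congr (op (op (F _) (F _)) (F _)); exact/val_inj.
Qed.

Definition vec3 (R : nmodType) (a b c : R) : 'I_3 -> R :=
  fun i => [:: a; b; c]`_i.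

Lemma simplex3P (R : realFieldType) (p : 'I_3 -> R) :
  open_simplex p <-> [/\ 0 < p 0, 0 < p 1, 0 < p 2 & p 0 + p 1 + p 2 = 1].
Proof.
rewrite /open_simplex big_ord3; split=> [[p01 ->]|[p0 p1 p2 psum]].
  by split => //; [case/andP: (p01 0)|case/andP: (p01 1)|case/andP: (p01 2)].
by split => //; apply: ord3_ind; apply/andP; split => //; lra.
Qed.

(** * The witness and its polynomial bounds *)

Definition gap_function (R : realFieldType) (p : 'I_3 -> R) : R :=
  (p 0 - p 1) ^+ 2 + p 2 * (p 0 + p 1) / 2.

Lemma gap_function_lower_bounds (R : realFieldType) (p : 'I_3 -> R) :
  open_simplex p ->
  1 / 2 * (p 0 * p 1 * p 2) <= gap_function p /\
  1 / 2 * (p 0 * p 1 * p 2) <= 1 - gap_function p.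
Proof.
move=> /simplex3P[p0 p1 p2 psum]; rewrite /gap_function.
have h2 : p 0 * p 1 * p 2 <= p 0 * p 2.
  by rewrite mulrAC ler_piMr ?mulr_ge0 ?ltW //; lra.
have h3 : p 0 * p 1 * p 2 <= p 0 * p 1.
  by rewrite ler_piMr ?mulr_ge0 ?ltW //; lra.
(* Homogenising 1 as the square of the coordinate sum turns the right side into
   [4 p0 p1 + 3/2 p2 (p0 + p1) + p2^2], where every coefficient is positive. *)
have -> : 1 - ((p 0 - p 1) ^+ 2 + p 2 * (p 0 + p 1) / 2) =
    (p 0 + p 1 + p 2) ^+ 2 - ((p 0 - p 1) ^+ 2 + p 2 * (p 0 + p 1) / 2).
  by rewrite psum expr1n.
have s0 := sqr_ge0 (p 0 - p 1); have s2 := sqr_ge0 (p 2).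
have h01 := mulr_gt0 p0 p1; have h02 := mulr_gt0 p0 p2.
by have h12 := mulr_gt0 p1 p2; split; lra.
Qed.

Lemma gap_function_bounded (R : realFieldType) :
  polynomially_bounded (@gap_function R).
Proof.
exists (1 / 2), 1%N; split => [||p sp] //; first lra.
rewrite big_ord3 !expr1 le_min.
by have [-> ->] := gap_function_lower_bounds sp.
Qed.

Lemma gap_function_into_unit (R : realFieldType) :
  maps_into_unit (@gap_function R).
Proof.
move=> p sp; have [lb ub] := gap_function_lower_bounds sp.
have /simplex3P[p0 p1 p2 _] := sp.
by have := mulr_gt0 (mulr_gt0 p0 p1) p2; lra.
Qed.

(** * Rationality, Harnack inequality and the obstruction *)

Module Polynomials.
Import mpoly.

Lemma gap_function_rational (R : realFieldType) :
  rational_on_simplex (@gap_function R).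
Proof.
exists (('X_0 - 'X_1) ^+ 2 + 2^-1 *: ('X_2 * ('X_0 + 'X_1))), 1 => p _.
rewrite meval1 divr1 oner_eq0; split => //.
rewrite expr2 mevalD mevalZ !mevalM !mevalD mevalN !mevalXU -expr2.
by rewrite /gap_function [2^-1 * _]mulrC.
Qed.

Lemma bernstein_ge0 (R : realFieldType) (n : nat) (A : {mpoly R[n]})
    (v : 'I_n -> R) :
  bernstein A -> (forall i, 0 <= v i) -> 0 <= A.@[v].
Proof.
move=> [_ A0] v0; rewrite mevalE; apply: sumr_ge0 => m _.
by rewrite mulr_ge0 // prodr_ge0 // => i _; rewrite exprn_ge0.
Qed.

(** Every monomial of [A] has the same degree [d], so it grows by a factor of at most [M ^+ d] from
    [w] to [v]; non-negative coefficients allow these bounds to be added. *)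
Lemma bernstein_harnack (R : realFieldType) (n : nat) (A : {mpoly R[n]})
    (M : R) :
  bernstein A -> 0 <= M -> exists d : nat, forall v w : 'I_n -> R,
    (forall i, 0 <= v i) -> (forall i, v i <= M * w i) ->
    A.@[v] <= M ^+ d * A.@[w].
Proof.
move=> [[d /dhomogP Ad] A0] M0; exists d => v w v0 vw.
rewrite !mevalE mulr_sumr.
rewrite big_seq [leRHS]big_seq; apply: ler_sum => m mA.
rewrite mulrCA ler_wpM2l //.
rewrite -(Ad _ mA) /= mdegE expr_sum -big_split /=.
apply: ler_prod => i _; rewrite exprn_ge0 //= -exprMn.
by apply: lerXn2r; rewrite ?nnegrE ?vw // (le_trans (v0 i)).
Qed.

(** The numerator is compared from [v] to [w] and the denominator from [w] to [v], hence the
    domination in both directions. The constant does not depend on the two points. *)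
Lemma finite_automata_harnack (R : realFieldType) (s : nat)
    (f : ('I_s.+1 -> R) -> R) (M : R) :
  maps_into_unit f -> finite_automata_factory f -> 0 <= M ->
  exists K, forall v w, open_simplex v -> open_simplex w ->
    (forall i, v i <= M * w i) -> (forall i, w i <= M * v i) ->
    f v <= K * f w.
Proof.
move=> f01 [A [B [bA bB _ fAB]]] M0.
have [dA HA] := bernstein_harnack bA M0.
have [dB HB] := bernstein_harnack bB M0.
exists (M ^+ dA * M ^+ dB) => v w sv sw vw wv.
have v0 i : 0 <= v i by case: (sv) => /(_ i) /andP[/ltW].
have w0 i : 0 <= w i by case: (sw) => /(_ i) /andP[/ltW].
have Bgt0 u : open_simplex u -> 0 < B.@[u].
  move=> su; rewrite lt_neqAle bernstein_ge0 //; last first.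
    by move=> i; case: su => /(_ i) /andP[/ltW].
  (* Since the inverse of 0 is 0, a zero of [B] would give [f u = 0], against [f u > 0]. *)
  rewrite andbT; apply/eqP => B0.
  by have := f01 _ su; rewrite fAB // -B0 invr0 mulr0 ltxx.
have HAv := HA _ _ v0 vw; have HBw := HB _ _ w0 wv.
rewrite !fAB // ler_pdivrMr ?Bgt0 //.
set Av := A.@[v]; set Aw := A.@[w].
have -> : M ^+ dA * M ^+ dB * (Aw / B.@[w]) * B.@[v] =
    M ^+ dA * Aw * (M ^+ dB * B.@[v]) / B.@[w] by ring.
rewrite ler_pdivlMr ?Bgt0 //; apply: ler_pM => //.
- exact: bernstein_ge0.
- exact/ltW/Bgt0.
Qed.

End Polynomials.
Import Polynomials.

Lemma gap_function_not_finite_automata (R : realFieldType) :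
  ~ finite_automata_factory (@gap_function R).
Proof.
move=> fa.
have [K HK] := finite_automata_harnack (@gap_function_into_unit R) fa (ler0n _ 2).
have vecS a b c : 0 < a -> 0 < b -> 0 < c -> a + b + c = 1 ->
  open_simplex (vec3 a b c : 'I_3 -> R) by move=> *; exact/simplex3P.
pose L := Num.max K 1.
have [L1 KL] : 1 <= L /\ K <= L by rewrite /L !le_max !lexx orbT.
(* The Harnack bound will give [1 - t <= 9/2 L t], whereas this [t] makes [1 - t] equal to [9 L t],
   which is twice as large. *)
pose t := (1 + 9 * L)^-1.
have L9 : 0 < 1 + 9 * L by lra.
have t0 : 0 < t by rewrite invr_gt0.
have tL : t + 9 * (L * t) = 1 by rewrite /t; field; lra.
have Lt0 : 0 < L * t by rewrite mulr_gt0 //; lra.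
have t1 : t < 1 by lra.
have /HK : open_simplex (vec3 ((1 - t) / 3) (2 * (1 - t) / 3) t) by apply: vecS; lra.
have sv : open_simplex (vec3 ((1 - t) / 2) ((1 - t) / 2) t) by apply: vecS; lra.
move=> /(_ _ sv) H.
have : gap_function (vec3 ((1 - t) / 3) (2 * (1 - t) / 3) t) <=
    K * gap_function (vec3 ((1 - t) / 2) ((1 - t) / 2) t).
  by apply: H; apply: ord3_ind; rewrite /vec3 /=; lra.
rewrite /gap_function /vec3 /= => {}H.
have KG : K * (t * (1 - t)) <= L * (t * (1 - t)).
  by rewrite ler_wpM2r // mulr_ge0; lra.
have : (1 - t) * (1 - t) <= (1 - t) * (9 / 2 * (L * t)).
  by nra.
rewrite ler_pM2l; lra.
Qed.

From mathcomp Require Import all_classical all_reals all_analysis.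
Import numFieldNormedType.Exports.

Local Open Scope classical_set_scope.

(** * Weighted sums over words of fixed length *)

(** For a probability vector [p] this is the expectation of [h] at the word of the first [n]
    samples. *)
Definition word_sum (R : pzSemiRingType) (I : finType) (p : I -> R) (n : nat)
    (h : seq I -> R) : R :=
  \sum_(t : n.-tuple I) h t * \prod_(i <- t) p i.

Lemma word_sum0 (R : pzSemiRingType) (I : finType) (p : I -> R)
    (h : seq I -> R) : word_sum p 0 h = h [::].
Proof.
rewrite /word_sum (big_pred1 [tuple]) => [|t]; first by rewrite big_nil mulr1.
by apply/esym/eqP; exact: tuple0.
Qed.

Lemma word_sumS (R : comPzSemiRingType) (I : finType) (p : I -> R) (n : nat)
    (h : seq I -> R) :
  word_sum p n.+1 h = \sum_i p i * word_sum p n (fun t => h (i :: t)).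
Proof.
rewrite /word_sum.
under [RHS]eq_bigr do rewrite big_distrr /=.
rewrite pair_bigA /=.
rewrite (reindex (fun u : I * n.-tuple I => [tuple of u.1 :: u.2])) /=; last first.
  exists (fun t : n.+1.-tuple I => (thead t, [tuple of behead t])) => [[i t] _|t _] /=.
    by congr (_, _); exact/val_inj.
  by rewrite -tuple_eta.
by apply: eq_bigr => -[i t] _ /=; rewrite big_cons mulrCA.
Qed.

Lemma eq_word_sum (R : pzSemiRingType) (I : finType) (p : I -> R) (n : nat)
    (h k : seq I -> R) :
  (forall t, size t = n -> h t = k t) -> word_sum p n h = word_sum p n k.
Proof. by move=> hk; apply: eq_bigr => t _; rewrite hk ?size_tuple. Qed.

Lemma word_sumZ (R : pzSemiRingType) (I : finType) (p : I -> R) (n : nat)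
    (c : R) (h : seq I -> R) :
  word_sum p n (fun t => c * h t) = c * word_sum p n h.
Proof. by rewrite /word_sum [RHS]big_distrr /=; apply: eq_bigr => t _; rewrite mulrA. Qed.

(** * Events determined by a finite prefix and the uniform variable *)

Lemma mkseq_eqP (I : eqType) (x0 : I) (x : nat -> I) n (t : n.-tuple I) :
  mkseq x n = t <-> forall j, (j < n)%N -> x j = nth x0 t j.
Proof.
split=> [<- j jn|xt]; first by rewrite nth_mkseq.
apply: (@eq_from_nth _ x0) => [|j]; first by rewrite size_mkseq size_tuple.
by rewrite size_mkseq => jn; rewrite nth_mkseq ?xt.
Qed.

(** The letter 0 also serves below as the default value of [nth] on words. *)
HB.instance Definition _ (s : nat) := isPointed.Build 'I_s.+1 ord0.

Lemma filtration_word (R : realType) (s n : nat)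
    (A : seq 'I_s.+1 -> set R) :
  (forall t, measurable (A t)) ->
  @input_filtration R s n [set w | A (mkseq w.2 n) w.1].
Proof.
move=> mA; rewrite /input_filtration; set G := [set E | _ \/ _].
pose cyl (t : n.-tuple 'I_s.+1) : set (input_space R s) :=
  [set w | A t w.1] `&` \bigcap_(j in [set j | (j < n)%N])
    [set w | w.2 j = nth ord0 t j].
have -> : [set w | A (mkseq w.2 n) w.1] = \bigcup_(t : n.-tuple 'I_s.+1) cyl t.
  apply/seteqP; split => [w /= Aw|w [t _ [/= Aw wt]]].
    exists [tuple of mkseq w.2 n] => //; split => //= j /= jn.
    by rewrite nth_mkseq.
  by have -> : mkseq w.2 n = t by apply/(mkseq_eqP ord0).
have GU E : G E -> @measurable _ (g_sigma_algebraType G) E.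
  exact: sub_sigma_algebra.
(* The generated sigma-algebra is viewed as that of a measurable type, which gives closure under
   finite unions and intersections. *)
change (@measurable _ (g_sigma_algebraType G)
  (\bigcup_(t in [set: n.-tuple 'I_s.+1]) cyl t)).
apply: fin_bigcup_measurable => [|t _]; first exact: finite_finset.
apply: measurableI; first by apply: GU; left; exists (A t).
apply: bigcap_measurableType => j /= jn; apply: GU; right.
by exists j, (nth ord0 t j).
Qed.

(** The event splits into disjoint cylinders, one for each word of length [n]; independence factors
    the probability of each. *)
Lemma word_event_prob (R : realType) (s : nat) (p : 'I_s.+1 -> R)
    (d : measure_display) (Omega : measurableType d) (P : probability Omega R)
    (U : {RV P >-> R}) (X : nat -> Omega -> 'I_s.+1) (n : nat)
    (A : seq 'I_s.+1 -> set R) (u : seq 'I_s.+1 -> R) :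
  iid_input p U X -> (forall t, measurable (A t)) ->
  (forall t, uniform_prob (@ltr01 R) (A t) = (u t)%:E) ->
  measurable [set o | A (mkseq (X ^~ o) n) (U o)] /\
  P [set o | A (mkseq (X ^~ o) n) (U o)] = (word_sum p n u)%:E.
Proof.
move=> iid mA uA.
pose cyl (t : n.-tuple 'I_s.+1) : set Omega :=
  U @^-1` (A t) `&` \bigcap_(j in [set j | (j < n)%N])
    X j @^-1` [set nth ord0 t j].
have cylP t o : cyl t o <-> A t (U o) /\ mkseq (X ^~ o) n = t.
  by rewrite (mkseq_eqP ord0).
have -> : [set o | A (mkseq (X ^~ o) n) (U o)] =
    \bigcup_(t in [set: n.-tuple 'I_s.+1]) cyl t.
  apply/seteqP; split => [w /= Aw|w [t _ /cylP [Aw /= ->]]] //.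
  by exists [tuple of mkseq (X ^~ w) n] => //; apply/cylP.
have mcyl t : measurable (cyl t).
  apply: measurableI; last first.
    by apply: bigcap_measurableType => j _; exact: (input_measurable iid).
  by rewrite -[_ @^-1` _]setTI; exact: measurable_funP.
split; first by apply: fin_bigcup_measurable => //; exact: finite_finset.
rewrite measure_fin_bigcup //; last 2 first.
- exact: finite_finset.
- by move=> t1 t2 _ _ [w [/cylP [_ e1] /cylP [_ e2]]]; apply/val_inj; rewrite /= -e1 -e2.
have -> : [set: n.-tuple 'I_s.+1] = [set` enum {: n.-tuple 'I_s.+1}].
  by apply/seteqP; split => t //= _; rewrite mem_enum.
rewrite -fsbig_seq ?enum_uniq // big_enum /= /word_sum -sumEFin.
apply: eq_bigr => t _.
rewrite (input_independent iid) //= EFinM; congr (_ * _)%E.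
  by rewrite -uA -(input_uniform iid).
rewrite (big_nth ord0) size_tuple big_mkord -prodEFin.
by apply: eq_bigr => j _; rewrite (input_law iid).
Qed.

Lemma uniform_prob_le (R : realType) (a : R) :
  0 <= a <= 1 -> uniform_prob (@ltr01 R) `]-oo, a] = a%:E.
Proof.
move=> /andP[a0 a1]; rewrite /uniform_prob integral_uniform_pdf.
have -> : `]-oo, a]%classic `&` `[0, 1]%classic = `[0, a]%classic :> set R.
  apply/seteqP; split => x /=; rewrite !in_itv /=.
    by case=> -> /andP[-> _].
  by move=> /andP[-> xa]; rewrite xa (le_trans xa).
transitivity (\int[@lebesgue_measure R]_(x in `[0%R, a]) (cst 1%E x))%E.
  apply: eq_integral => x; rewrite inE /= in_itv /= => /andP[x0 xa].
  by rewrite /uniform_pdf x0 (le_trans xa a1) subr0 invr1.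
rewrite integral_cst //= lebesgue_measure_itv /= lte_fin mul1e.
case: ltgtP a0 => [_ _|//|<- _]; first by rewrite -EFinB subr0.
by [].
Qed.

(** * Factories stopping on a prefix-free set of words *)

Lemma prefix_free_unique (I : Type) (D : pred (seq I)) (x : nat -> I) m n :
  (forall t v, D t -> D (t ++ v) -> v = [::]) ->
  D (mkseq x m) -> D (mkseq x n) -> m = n.
Proof.
move=> pfD; wlog mn : m n / (m <= n)%N.
  move=> H Dm Dn; case/orP: (leq_total m n) => le; first exact: H.
  by apply/esym/H.
move=> Dm; rewrite -(subnKC mn) /mkseq iotaD map_cat add0n => Dn.
have /(congr1 size) := pfD _ _ Dm Dn; rewrite size_map size_iota /= => ->.
by rewrite addn0.
Qed.

(** Prefix-freeness makes the events for different stopping lengths disjoint, so sigma-additivity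
    turns the series into a probability. *)
Lemma stopped_event_prob (R : realType) (s : nat) (p : 'I_s.+1 -> R)
    (d : measure_display) (Omega : measurableType d) (P : probability Omega R)
    (U : {RV P >-> R}) (X : nat -> Omega -> 'I_s.+1) (D : pred (seq 'I_s.+1))
    (A : seq 'I_s.+1 -> set R) (u : seq 'I_s.+1 -> R) (l : R) :
  iid_input p U X ->
  (forall t v, D t -> D (t ++ v) -> v = [::]) ->
  (forall t x, A t x -> D t) ->
  (forall t, measurable (A t)) ->
  (forall t, uniform_prob (@ltr01 R) (A t) = (u t)%:E) ->
  series (fun n => word_sum p n u) @ \oo --> l ->
  let E := [set o | exists n, A (mkseq (X ^~ o) n) (U o)] in
  measurable E /\ P E = l%:E.
Proof.
move=> iid pfD AD mA uA ul E.
pose F n := [set o | A (mkseq (X ^~ o) n) (U o)].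
have FE : E = \bigcup_n F n.
  by apply/seteqP; split => [w [n Aw]|w [n _ Aw]]; exists n.
have mF n : measurable (F n) by case: (word_event_prob n iid mA uA).
have PF n : P (F n) = (word_sum p n u)%:E.
  by case: (word_event_prob n iid mA uA).
rewrite FE; split; first exact: bigcupT_measurable.
have tF : trivIset setT F.
  move=> m n _ _ [w [/AD Dm /AD Dn]]; exact: prefix_free_unique pfD Dm Dn.
have cP := @measure_sigma_additive _ _ _ P F mF tF.
apply: (cvg_unique (@ereal_hausdorff R) cP).
have -> : (fun n => (\sum_(0 <= i < n) P (F i))%E) =
          EFin \o series (fun n => word_sum p n u).
  by apply/funext => n /=; rewrite /series /= -sumEFin; apply: eq_bigr.
by apply: cvg_EFin => //; exact: nearW.
Qed.

(** The procedure reads until the word [t] lies in [D], then outputs 1 when [U <= F t]. The two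
    series are the probabilities of halting and of output 1. *)
Lemma prefix_free_factory (R : realType) (s : nat) (D : pred (seq 'I_s.+1))
    (F : seq 'I_s.+1 -> R) (f : ('I_s.+1 -> R) -> R) :
  (forall t v, D t -> D (t ++ v) -> v = [::]) ->
  (forall t, D t -> 0 <= F t <= 1) ->
  (forall p, open_simplex p ->
    series (fun n => word_sum p n (fun t => (D t)%:R)) @ \oo --> (1 : R)) ->
  (forall p, open_simplex p ->
    series (fun n => word_sum p n (fun t => (D t)%:R * F t)) @ \oo --> f p) ->
  admits_bernoulli_factory f.
Proof.
move=> pfD F01 D1 Df.
pose halts (w : input_space R s) := exists n, D (mkseq w.2 n).
pose T (w : input_space R s) : option nat :=
  if pselect (halts w) is left h then Some (ex_minn h) else None.
(* Stopping at [n] thus depends on the first [n] samples alone, as a stopping time requires. *)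
have TE w n : (T w = Some n) = (D (mkseq w.2 n) : Prop).
  apply/propext; rewrite /T; case: pselect => [h|nh]; last first.
    by split => // Dn; case: nh; exists n.
  case: ex_minnP => m Dm _; split => [[<-]//|Dn].
  by rewrite (prefix_free_unique pfD Dm Dn).
have TN w : T w <> None <-> halts w.
  rewrite /T; case: pselect => [h|nh] //; split => //.
pose out (w : input_space R s) : bool :=
  if T w is Some n then w.1 <= F (mkseq w.2 n) else false.
(* Values of the uniform variable for which the procedure stops at [t] ([A0]), or stops there with
   output 1 ([A1]). *)
pose A0 t : set R := if D t then setT else set0.
pose A1 t : set R := if D t then `]-oo, F t]%classic else set0.
have mA0 t : measurable (A0 t) by rewrite /A0; case: (D t).
have mA1 t : measurable (A1 t) by rewrite /A1; case: (D t).
have outE n w : (T w = Some n /\ out w) = A1 (mkseq w.2 n) w.1.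
  apply/propext; rewrite /A1 /out; split.
    by case=> e; rewrite e; move: e; rewrite TE => -> /=; rewrite in_itv.
  case: ifPn => // Dn /=; have e : T w = Some n by rewrite TE.
  by rewrite in_itv /= e.
exists T, out; split.
- move=> n; have := filtration_word (n := n) mA0; congr (input_filtration _).
  by apply/funext => w; rewrite /= TE /A0; case: (D _); apply/propext.
- move=> n; have := filtration_word (n := n) mA1; congr (input_filtration _).
  by apply/funext => w; rewrite /= outE.
move=> p sp d Omega P U X iid.
have u0 t : uniform_prob (@ltr01 R) (A0 t) = ((D t)%:R)%:E.
  by rewrite /A0; case: (D t); rewrite ?measure0 //; exact: probability_setT.
have u1 t : uniform_prob (@ltr01 R) (A1 t) = ((D t)%:R * F t)%:E.
  rewrite /A1; case: ifPn => Dt; last by rewrite measure0 mul0r.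
  by rewrite uniform_prob_le ?F01 // mul1r.
have AD0 t x : A0 t x -> D t by rewrite /A0; case: (D t).
have AD1 t x : A1 t x -> D t by rewrite /A1; case: (D t).
have [mE0 PE0] := stopped_event_prob iid pfD AD0 mA0 u0 (D1 p sp).
have [mE1 PE1] := stopped_event_prob iid pfD AD1 mA1 u1 (Df p sp).
split.
  exists (~` [set o | exists n, A0 (mkseq (X ^~ o) n) (U o)]); split.
  - exact: measurableC.
  - by rewrite probability_setC // PE0 subee.
  - move=> w /= nT [n An]; apply: nT; apply/TN; exists n.
    exact: AD0 An.
rewrite -PE1; congr (P _); apply/seteqP; split => w /=.
  case=> /TN [n Dn] ow; exists n; rewrite -(outE n (U w, X ^~ w)); split => //.
  by rewrite TE.
by case=> n; rewrite -(outE n (U w, X ^~ w)) => -[-> ->].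
Qed.

(** * Geometric series with quadratic coefficients *)

(** [1 - x ^+ n] is [1 - x] times a sum of [n] powers of [x], each at least [x ^+ n]. *)
Lemma natmul_expr_le (R : realFieldType) (x : R) n :
  0 <= x <= 1 -> n%:R * x ^+ n * (1 - x) <= 1 - x ^+ n.
Proof.
move=> /andP[x0 x1]; elim: n => [|n IH]; first by rewrite expr0 subrr !mul0r.
rewrite exprS -natr1.
have xn0 : 0 <= x ^+ n by rewrite exprn_ge0.
have xn1 : x * x ^+ n <= 1 by rewrite -exprS exprn_ile1 ?x0.
have h : 0 <= (1 - x) * (1 - x * x ^+ n) by rewrite mulr_ge0 ?subr_ge0.
by have := ler_wpM2l x0 IH; lra.
Qed.

(** With [r] the square root of [x], the term is [(n r^n) r^n], whose first factor is at most
    [(1 - r)^-1]. *)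
Lemma cvg_natmul_expr (R : realType) (x : R) :
  0 < x < 1 -> (fun n => n%:R * x ^+ n : R) @ \oo --> (0 : R).
Proof.
move=> /andP[x0 x1]; pose r := Num.sqrt x.
have r0 : 0 < r by rewrite sqrtr_gt0.
have xr : x = r ^+ 2 by rewrite sqr_sqrtr // ltW.
have r1 : r < 1 by rewrite ltNge; apply/negP => r1; nra.
have rn : (fun n => (1 - r)^-1 * r ^+ n : R) @ \oo --> (0 : R).
  rewrite -(mulr0 (1 - r)^-1); apply: cvgMr; apply: cvg_expr.
  by rewrite ger0_norm // ltW.
apply: (squeeze_cvgr _ (cvg_cst 0) rn); apply: nearW => n.
rewrite xr -exprM mul2n -addnn exprD mulrA.
rewrite mulr_ge0 ?mulr_ge0 ?exprn_ge0 ?ler0n ?(ltW r0) //=.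
rewrite ler_wpM2r ?exprn_ge0 ?(ltW r0) // -[leRHS]mul1r ler_pdivlMr ?subr_gt0 //.
apply: le_trans (natmul_expr_le n _) _; first by rewrite !ltW.
by rewrite lerBlDr lerDl exprn_ge0 // ltW.
Qed.

Lemma cvg_natmul2_expr (R : realType) (x : R) :
  0 < x < 1 -> (fun n => n%:R ^+ 2 * x ^+ n : R) @ \oo --> (0 : R).
Proof.
move=> /andP[x0 x1]; pose r := Num.sqrt x.
have r0 : 0 < r by rewrite sqrtr_gt0.
have xr : x = r ^+ 2 by rewrite sqr_sqrtr // ltW.
have r1 : r < 1 by rewrite ltNge; apply/negP => r1; nra.
have cr : (fun n => n%:R * r ^+ n : R) @ \oo --> (0 : R).
  by apply: cvg_natmul_expr; rewrite r0.
have -> : (fun n => n%:R ^+ 2 * x ^+ n : R) =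
    (fun n => (n%:R * r ^+ n) * (n%:R * r ^+ n)).
  by apply/funext => n; rewrite xr -exprM mul2n -addnn exprD; ring.
by rewrite -(mulr0 0); exact: cvgM.
Qed.

(* The coefficients are chosen so that the terms are
   [v n - v n.+1] with [v n = x ^+ n * (a * n ^ 2 + b * n + c)]. *)
Lemma cvg_quadratic_geometric_series (R : realType) (x a b c : R) :
  0 < x < 1 ->
  series (fun n => x ^+ n * (a * (1 - x) * n%:R ^+ 2 +
    (b * (1 - x) - 2 * a * x) * n%:R + (c * (1 - x) - x * (a + b)))) @ \oo --> c.
Proof.
move=> x01.
have xn : (fun n => x ^+ n : R) @ \oo --> (0 : R).
  by case/andP: (x01) => x0 x1; apply: cvg_expr; rewrite ger0_norm // ltW.
rewrite [X in X @ _](_ : _ = (fun n => c - (a * (n%:R ^+ 2 * x ^+ n) +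
    b * (n%:R * x ^+ n) + c * x ^+ n))); last first.
  apply/funext; elim=> [|n IH].
    by rewrite /series /= big_geq // !expr0; ring.
  by rewrite seriesSr IH (exprS x) -(natr1 n); ring.
rewrite -[X in _ --> X]subr0; apply: cvgB; first exact: cvg_cst.
rewrite [X in _ --> X](_ : 0 = a * 0 + b * 0 + c * 0 :> R); last by ring.
apply: cvgD; last exact: cvgMr.
apply: cvgD; apply: cvgMr; first exact: cvg_natmul2_expr.
exact: cvg_natmul_expr.
Qed.

(** * Words ending at the k-th waiting symbol, and their walk *)

(** The waiting symbol is 2: these words contain it [k] times and end with its last occurrence, or
    are empty if [k = 0]. *)
Fixpoint completes (k : nat) (t : seq 'I_3) : bool :=
  match k, t with
  | 0, [::] => true
  | k'.+1, i :: t' => completes (if i == 2 then k' else k) t'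
  | _, _ => false
  end.

Lemma completes_prefix_free k t v :
  completes k t -> completes k (t ++ v) -> v = [::].
Proof.
elim: t k => [|i t IH] [|k] //=; first by case: v.
exact: IH.
Qed.

Definition step (R : pzRingType) (i : 'I_3) : R := (i == 0)%:R - (i == 1)%:R.

Definition walk (R : pzRingType) (t : seq 'I_3) : R := \sum_(i <- t) step R i.

(** Exactly [size t - k] letters differ from 2, and only these move the walk, by one unit each. *)
Lemma completes_size_walk (R : realDomainType) k t : completes k t ->
  (k <= size t)%N /\ `|walk R t| <= (size t - k)%:R.
Proof.
elim: t k => [|i t IH] [|k] //=.
  by move=> _; rewrite /walk big_nil normr0.
rewrite /walk big_cons -/(walk R t); move: i.
apply: ord3_ind => /= /IH [sz bd].
- rewrite (leqW sz); split => //; rewrite subSn // -natr1 addrC.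
  by apply: le_trans (ler_normD _ _) _; rewrite lerD // /step /= subr0 normr1.
- rewrite (leqW sz); split => //; rewrite subSn // -natr1 addrC.
  by apply: le_trans (ler_normD _ _) _; rewrite lerD // /step /= sub0r normrN1.
- by rewrite ltnS sz subSS /step /= subrr add0r.
Qed.

Lemma word_sum_completes0 (R : pzSemiRingType) (p : 'I_3 -> R) n k h :
  (n < k)%N || (k == 0)%N && (0 < n)%N ->
  word_sum p n (fun t => (completes k t)%:R * h t) = 0.
Proof.
move=> nk; rewrite /word_sum big1 // => t _.
case: (boolP (completes k t)) => [ct|]; last by rewrite !mul0r.
(* Only the length bound is wanted; [int] is an arbitrary choice of ordered ring. *)
have [+ _] := completes_size_walk int ct; rewrite size_tuple leqNgt.
case/orP: nk => [->//|/andP[/eqP k0 n0] _]; exfalso.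
by move: n0 ct; rewrite k0 -{1}(size_tuple t); case: (tval t).
Qed.

(* The waiting symbol occupies the last place and any [k] of the other
   [m + k] places; [q m s] is the expectation of [q 0] after [m] weighted
   steps of the walk started at [s]. *)
Lemma word_sum_completes (R : comPzRingType) (p : 'I_3 -> R)
    (q : nat -> R -> R) :
  (forall m s, p 0 * q m (s + 1) + p 1 * q m (s - 1) = q m.+1 s) ->
  forall k m s,
  word_sum p (m + k).+1
    (fun t => (completes k.+1 t)%:R * q 0 (s + walk R t)) =
  'C(m + k, k)%:R * p 2 ^+ k.+1 * q m s.
Proof.
move=> qS.
(* First-step analysis: 0 and 1 shift the starting point, 2 lowers the number of awaited symbols. *)
have first_step n k s :
    word_sum p n.+1 (fun t => (completes k.+1 t)%:R * q 0 (s + walk R t)) =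
    p 0 * word_sum p n (fun t => (completes k.+1 t)%:R * q 0 (s + 1 + walk R t))
    + p 1 * word_sum p n (fun t => (completes k.+1 t)%:R * q 0 (s - 1 + walk R t))
    + p 2 * word_sum p n (fun t => (completes k t)%:R * q 0 (s + walk R t)).
  rewrite word_sumS big_ord3; congr (_ * _ + _ * _ + _ * _);
    apply: eq_word_sum => t _ /=; rewrite /walk big_cons /step /=.
  - by rewrite subr0 addrA.
  - by rewrite sub0r addrA.
  - by rewrite subrr add0r.
elim=> [|k IHk].
  elim=> [|m IHm] s.
    by rewrite first_step !word_sum0 /= /walk big_nil !addr0 bin0; ring.
  rewrite first_step addn0 -[in RHS]qS.
  rewrite [X in p 2 * X]word_sum_completes0 //.
  have := IHm; rewrite addn0 => {}IHm.
  by rewrite !IHm !bin0; ring.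
elim=> [|m IHm] s.
  have := IHk 0%N s; rewrite add0n => IH0.
  rewrite add0n first_step IH0 !word_sum_completes0 ?ltnSn //.
  by rewrite !binn (exprS _ k.+1); ring.
(* The first letters 0 and 1 contribute ['C(m + k.+1, k.+1)], the first letter 2 contributes
   ['C(m + k.+1, k)]; Pascal's rule adds them. *)
have := IHk m.+1 s; rewrite addSnnS => IH1.
rewrite addSn first_step !IHm IH1 -qS binS natrD !exprS; ring.
Qed.

(** * Halting probability and acceptance probability *)

Lemma cvg_series_drop (R : realType) (u : nat -> R) k (l : R) :
  (forall n, (n < k)%N -> u n = 0) ->
  series (fun n => u (n + k)%N) @ \oo --> l -> series u @ \oo --> l.
Proof.
move=> u0; rewrite -(cvg_shiftn k (series u)).
have -> : series (fun n => u (n + k)%N) = (fun n => series u (n + k)%N).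
  apply/funext; elim=> [|n IH]; last by rewrite addSn !seriesSr IH.
  by rewrite add0n /series /= big_geq // big_nat big1.
by [].
Qed.

Lemma natr_bin2 (R : fieldType) n : 2 != 0 :> R ->
  'C(n.+2, 2)%:R = (n.+2 * n.+1)%:R / 2 :> R.
Proof.
move=> R2; apply: (canRL (mulfK R2)).
by rewrite -[2]/(2`!%:R) -natrM bin_ffact ffactnS ffactn1.
Qed.

(** This is the total mass of a negative binomial law: length [n + 3] has probability
    ['C(n + 2, 2) p2^3 x^n]. *)
Lemma completes_third_prob (R : realType) (p : 'I_3 -> R) : open_simplex p ->
  series (fun n => word_sum p n (fun t => (completes 3 t)%:R)) @ \oo --> (1 : R).
Proof.
move=> /simplex3P[p0 p1 p2 psum]; pose x := p 0 + p 1.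
have mul1 n : word_sum p n (fun t => (completes 3 t)%:R) =
    word_sum p n (fun t => (completes 3 t)%:R * 1).
  by apply: eq_word_sum => t _; rewrite mulr1.
apply: (@cvg_series_drop _ _ 3) => [n n3|].
  by rewrite mul1 word_sum_completes0 ?n3.
have x01 : 0 < x < 1 by rewrite /x; lra.
have p2E : p 2 = 1 - x by rewrite /x -psum; ring.
(* The parameters come from matching coefficients with [(1 - x)^3 (n + 1)(n + 2) / 2]. *)
have := @cvg_quadratic_geometric_series R x ((1 - x) ^+ 2 / 2)
  (3 * (1 - x) ^+ 2 / 2 + (1 - x) * x) 1 x01.
apply: cvg_trans; apply: near_eq_cvg; apply: nearW => N.
apply: eq_bigr => n _; rewrite !addnS addn0.
symmetry; transitivity ('C(n.+2, 2)%:R * p 2 ^+ 3 * x ^+ n).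
  rewrite mul1.
  have := @word_sum_completes R p (fun m _ => x ^+ m) _ 2 n 0.
  rewrite expr0 !addnS addn0 => -> // m s.
  by rewrite -mulrDl exprS.
by rewrite natr_bin2 // natrM p2E -(natr1 n.+1) -(natr1 n); field.
Qed.

(** A word stopped at the third 2 with [n] other letters has length [n + 3], so the denominator is
    [(n + 2)(n + 1)]. *)
Definition acceptance (R : realFieldType) (t : seq 'I_3) : R :=
  walk R t ^+ 2 / ((size t).-1 * (size t).-2)%:R.

Lemma acceptance_unit (R : realFieldType) t :
  completes 3 t -> 0 <= acceptance R t <= 1.
Proof.
case/(completes_size_walk R) => sz bd; rewrite /acceptance.
case: (size t) sz bd => [|[|[|n]]] // _; rewrite !subSS subn0 => bd.
rewrite divr_ge0 ?sqr_ge0 //= ler_pdivrMr ?ltr0n ?muln_gt0 // mul1r.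
rewrite -real_normK ?num_real // natrM expr2.
by apply: ler_pM => //; apply: le_trans bd _; rewrite ler_nat ?leqW.
Qed.

(* [q m 0] is [x ^+ m] times the second moment of a sum of [m] independent
   signs with mean [c], [x] and [c] being the probability of a sign and the
   conditional mean. *)
Lemma acceptance_expectation (R : realType) (p : 'I_3 -> R) : open_simplex p ->
  series (fun n => word_sum p n (fun t => (completes 3 t)%:R * acceptance R t))
    @ \oo --> gap_function p.
Proof.
move=> /simplex3P[p0 p1 p2 psum]; pose x := p 0 + p 1.
pose c := (p 0 - p 1) / x.
apply: (@cvg_series_drop _ _ 3) => [n n3|].
  by rewrite word_sum_completes0 ?n3.
have x01 : 0 < x < 1 by rewrite /x; lra.
have x0 : x != 0 by apply/lt0r_neq0; case/andP: x01.
have p2E : p 2 = 1 - x by rewrite /x -psum; ring.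
pose q m s := x ^+ m * ((s + m%:R * c) ^+ 2 + m%:R * (1 - c ^+ 2)).
have p0E : p 0 = x * (1 + c) / 2 by rewrite /c /x; field.
have p1E : p 1 = x * (1 - c) / 2 by rewrite /c /x; field.
have qS m s : p 0 * q m (s + 1) + p 1 * q m (s - 1) = q m.+1 s.
  by rewrite p0E p1E /q -(natr1 m) (exprS x); field.
have -> : gap_function p = x * ((1 - x) / 2 + c ^+ 2 * x).
  by rewrite /gap_function p0E p1E p2E; field.
(* Here the quadratic to match is [(1 - x)^3 (c^2 n^2 + (1 - c^2) n) / 2], without constant term. *)
have := @cvg_quadratic_geometric_series R x ((1 - x) ^+ 2 * c ^+ 2 / 2)
  ((1 - x) ^+ 2 * (1 - c ^+ 2) / 2 + (1 - x) * c ^+ 2 * x)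
  (x * ((1 - x) / 2 + c ^+ 2 * x)) x01.
apply: cvg_trans; apply: near_eq_cvg; apply: nearW => N.
apply: eq_bigr => n _; rewrite !addnS addn0.
have n1 : n.+2%:R != 0 :> R by rewrite pnatr_eq0.
have n2 : n.+1%:R != 0 :> R by rewrite pnatr_eq0.
symmetry; transitivity ((n.+2 * n.+1)%:R^-1 * ('C(n.+2, 2)%:R * p 2 ^+ 3 * q n 0)).
  have := @word_sum_completes R p q qS 2 n 0.
  rewrite !addnS addn0 => <-; rewrite -word_sumZ.
  apply: eq_word_sum => t st; rewrite /acceptance st /= /q expr0 mul0r.
  by rewrite !add0r !mul0r !addr0 mul1r; ring.
rewrite natr_bin2 // natrM p2E /q.
by move: n1 n2; rewrite -(natr1 n.+1) -(natr1 n) => n1 n2; field; rewrite n1 n2.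
Qed.

Theorem theorem3p1 (R : realType) :
  exists g : ('I_3 -> R) -> R,
    [/\ maps_into_unit g,
        rational_on_simplex g,
        polynomially_bounded g,
        admits_bernoulli_factory g &
        ~ finite_automata_factory g].
Proof.
exists (@gap_function R); split.
- exact: gap_function_into_unit.
- exact: gap_function_rational.
- exact: gap_function_bounded.
- apply: (@prefix_free_factory R 2 (completes 3) (@acceptance R)).
  + exact: completes_prefix_free.
  + exact: acceptance_unit.
  + exact: completes_third_prob.
  + exact: acceptance_expectation.
- exact: gap_function_not_finite_automata.
Qed.
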